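(* Let $A\colon\mathcal{D}(A)\subseteq\mathcal{H}\to\mathcal{K}$ be a closed, densely defined linear operator between Hilbert spaces and let $A=UT_\sigma V^*$ be its condensed singular value decomposition. For $\varepsilon\in[0,\infty)$, the operator $A-UT_{\mathbf{1}_{\{\sigma\ge\varepsilon\}}\sigma}V^*$ extends uniquely to a bounded operator $E$ (from $\mathcal{H}$ to $\mathcal{K}$) such that $\lVert E\rVert\le\varepsilon$.
   Context: All Hilbert spaces are separable and complex; $\mathcal{L}(\mathcal{H},\mathcal{K})$ denotes the bounded linear operators from $\mathcal{H}$ to $\mathcal{K}$. For a measure space $(M,\mu)$ and measurable $g$ on $M$, $L^2_\mu=L^2(M,\mu)$ and $T_g$ is multiplication by $g$ with domain $\{f\in L^2_\mu:gf\in L^2_\mu\}$. A condensed singular value decomposition $A=UT_\sigma V^*$ consists of a $\sigma$-finite Borel measure space $(M,\mu)$, isometries $U\in\mathcal{L}(L^2_\mu,\mathcal{K})$, $V\in\mathcal{L}(L^2_\mu,\mathcal{H})$, and a measurable $\sigma\colon M\to[0,\infty)$ positive almost everywhere such that $\mathcal{D}(A)=\{x\in\mathcal{H}:V^*x\in\mathcal{D}(T_\sigma)\}$ and $Ax=UT_\sigma V^*x$ for all $x\in\mathcal{D}(A)$. Sums and differences of unbounded operators are defined on the intersection of the domains, and compositions on their natural domains. *)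

(* Defs.v *)
From HB Require Import structures.
From mathcomp Require Import all_boot all_order all_algebra.
From mathcomp Require Import complex.
From mathcomp Require Import all_classical all_reals all_analysis.
From mathcomp Require Import measurable_realfun.
From mathcomp Require Import ring.

Set Implicit Arguments.
Unset Strict Implicit.
Unset Printing Implicit Defensive.

Import Order.TTheory GRing.Theory Num.Theory.
Import numFieldNormedType.Exports.

Local Open Scope classical_set_scope.
Local Open Scope ring_scope.
Local Open Scope complex_scope.
Local Open Scope quotient_scope.

(** Norms of complex normed modules take their values in [R[i]]; [rnorm x] is
    the same number seen in [R]. *)
Definition rnorm (R : realType) (V : normedZmodType R[i]) (x : V) : R :=
  complex.Re `|x|.

Lemma rnorm_ge0 (R : realType) (V : normedZmodType R[i]) (x : V) :
  0 <= rnorm x.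
Proof. by have := normr_ge0 x; rewrite lecE => /andP[]. Qed.

(** The inner product is linear in its first argument. *)
HB.mixin Record NormedModule_isPreHilbert (R : realType) (H : Type)
    & NormedModule R[i] H := {
  inner : {dot H for @Num.conj R[i]} ;
  inner_norm : forall x : H, `|x| ^+ 2 = inner x x
}.

#[short(type="preHilbertType")]
HB.structure Definition PreHilbert (R : realType) :=
  {H of NormedModule R[i] H & NormedModule_isPreHilbert R H}.

#[short(type="hilbertType")]
HB.structure Definition Hilbert (R : realType) :=
  {H of PreHilbert R H & CompleteNormedModule R[i] H}.

Definition separable_space (T : topologicalType) : Prop :=
  exists2 D : set T, countable D & dense D.

Section DotTriangle.
Variables (R : realType) (V : lmodType R[i]) (form : {dot V for @Num.conj R[i]}).

Let N (u : V) : R := complex.Re (form u u).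

Lemma dot_sqrtD (u v : V) :
  Num.sqrt (N (u + v)) <= Num.sqrt (N u) + Num.sqrt (N v).
Proof.
have N0 w : 0 <= N w.
  have [->|/(@neq0_dnorm_gt0 _ _ _ form)] := eqVneq w 0.
    by rewrite /N linear0r.
  by rewrite ltcE => /andP[_ /ltW].
have NDZ (t : R) w z :
    N (w + t%:C *: z) = N w + 2 * t * complex.Re (form w z) + t ^+ 2 * N z.
  rewrite /N linearDl/= !linearDr/= !linearZl_LR/= !linearZr_LR/=.
  rewrite (@hermitian_subproof _ _ _ _ form z w)/= expr0 mul1r.
  case: (form w w) (form w z) (form z z) => a a' [b b'] [c c'] /=; simpc => /=.
  by rewrite /GRing.scale/=; ring.
have CS : complex.Re (form u v) <= Num.sqrt (N u) * Num.sqrt (N v).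
  rewrite -sqrtrM//; apply: le_trans (ler_norm _) _.
  rewrite -sqrtr_sqr ler_wsqrtr//.
  have [v0|v0] := eqVneq (N v) 0.
    have /eqP -> : v == 0.
      apply: contraTT isT => /(@neq0_dnorm_gt0 _ _ _ form).
      by rewrite ltcE => /andP[_]; rewrite -/(N v) v0 ltxx.
    by rewrite linear0r expr0n/= mulr_ge0.
  have vgt0 : 0 < N v by rewrite lt0r v0 N0.
  have := N0 (u + (- complex.Re (form u v) / N v)%:C *: v).
  rewrite NDZ; set r := complex.Re _.
  rewrite (_ : _ + _ = (N u * N v - r ^+ 2) / N v); last by field.
  by rewrite pmulr_lge0 ?invr_gt0// subr_ge0.
rewrite -(@ler_pXn2r _ 2)// ?nnegrE ?addr_ge0 ?sqrtr_ge0//.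
rewrite sqr_sqrtr// sqrrD !sqr_sqrtr//.
have := NDZ 1 u v; rewrite scale1r => ->.
rewrite mulr1 expr1n mul1r lerD2r lerD2l mulr2n mulrDl mul1r.
exact: lerD.
Qed.

End DotTriangle.

Section SquareIntegrable.
Context d (T : measurableType d) (R : realType).
Variable mu : {measure set T -> \bar R}.
Implicit Types f g h : T -> R[i].

(** Borel measurability into the complex plane, checked componentwise. *)
Definition measurable_cfun f : Prop :=
  measurable_fun setT (fun x => complex.Re (f x)) /\
  measurable_fun setT (fun x => complex.Im (f x)).

Definition square_integrable f : Prop :=
  measurable_cfun f /\ (\int[mu]_x (rnorm (f x) ^+ 2)%:E < +oo)%E.

Lemma rnorm2E (z : R[i]) :
  rnorm z ^+ 2 = complex.Re z ^+ 2 + complex.Im z ^+ 2.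
Proof. by rewrite /rnorm normc_def/= sqr_sqrtr// addr_ge0// sqr_ge0. Qed.

Lemma measurable_rnorm2 f : measurable_cfun f ->
  measurable_fun setT (fun x => rnorm (f x) ^+ 2).
Proof.
move=> [mr mi]; under eq_fun do rewrite rnorm2E.
by apply: measurable_funD; exact: measurable_funX.
Qed.

Lemma square_integrableP f : square_integrable f <->
  measurable_cfun f /\ mu.-integrable setT (fun x => (rnorm (f x) ^+ 2)%:E).
Proof.
split=> -[mf].
  move=> foo; split=> //; apply/integrableP; split.
    by apply/measurable_EFinP; exact: measurable_rnorm2.
  by under eq_integral do rewrite gee0_abs ?lee_fin ?sqr_ge0//.
move=> /integrableP[_]; split=> //.
by under eq_integral do rewrite -[X in X%:E]ger0_norm ?sqr_ge0//.
Qed.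

Lemma measurable_cfunD f g : measurable_cfun f -> measurable_cfun g ->
  measurable_cfun (f + g).
Proof.
move=> [f1 f2] [g1 g2]; split.
- rewrite (_ : (fun _ => _) = (fun x => complex.Re (f x)) \+
                              (fun x => complex.Re (g x))); last first.
    by apply/funext => x /=; rewrite fctE; case: (f x) (g x) => ? ? [].
  exact: measurable_funD.
- rewrite (_ : (fun _ => _) = (fun x => complex.Im (f x)) \+
                              (fun x => complex.Im (g x))); last first.
    by apply/funext => x /=; rewrite fctE; case: (f x) (g x) => ? ? [].
  exact: measurable_funD.
Qed.

Lemma measurable_cfunM f g : measurable_cfun f -> measurable_cfun g ->
  measurable_cfun (fun x => f x * g x).
Proof.
move=> [f1 f2] [g1 g2]; split.
- rewrite (_ : (fun _ => _) =
    (fun x => complex.Re (f x) * complex.Re (g x)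
            - complex.Im (f x) * complex.Im (g x))); last first.
    by apply/funext => x /=; case: (f x) (g x) => ? ? [].
  by apply: measurable_funB; exact: measurable_funM.
- rewrite (_ : (fun _ => _) =
    (fun x => complex.Re (f x) * complex.Im (g x)
            + complex.Im (f x) * complex.Re (g x))); last first.
    by apply/funext => x /=; case: (f x) (g x) => ? ? [].
  by apply: measurable_funD; exact: measurable_funM.
Qed.

Lemma measurable_cfunC f : measurable_cfun f ->
  measurable_cfun (fun x => (f x)^*).
Proof.
move=> [f1 f2]; split.
- rewrite (_ : (fun _ => _) = (fun x => complex.Re (f x)))//.
  by apply/funext => x /=; case: (f x).
- rewrite (_ : (fun _ => _) = (fun x => - complex.Im (f x))); last first.
    by apply/funext => x /=; case: (f x).
  exact: measurable_funN.
Qed.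

Lemma measurable_cfun_cst (c : R[i]) : measurable_cfun (fun=> c).
Proof. by split; exact: measurable_cst. Qed.

Definition L2_pred : {pred T -> R[i]} :=
  [pred f | `[< square_integrable f >]].

Lemma square_integrable_submod :
  submod_closed L2_pred.
Proof.
split=> [|a f g]; rewrite !inE.
  apply/square_integrableP; split; first exact: measurable_cfun_cst.
  rewrite (_ : (fun _ => _) = cst 0%E); first exact: integrable0.
  by apply/funext => x; rewrite rnorm2E/= expr0n/= addr0.
move=> /square_integrableP[mf fi] /square_integrableP[mg gi].
have maf : measurable_cfun (a *: f).
  by apply: (@measurable_cfunM (fun=> a)) => //; exact: measurable_cfun_cst.
apply/square_integrableP; split; first exact: measurable_cfunD.
have := integrableD measurableT
  (integrableZl measurableT (2 * rnorm a ^+ 2) fi) (integrableZl measurableT 2 gi).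
apply: le_integrable => //.
  apply/measurable_EFinP/measurable_rnorm2; exact: measurable_cfunD.
move=> x _ /=; rewrite lee_fin !ger0_norm ?sqr_ge0//; last first.
  by rewrite addr_ge0 ?mulr_ge0 ?exprn_ge0 ?rnorm_ge0.
rewrite !fctE !rnorm2E -mulrA.
case: (f x) (g x) a {maf} => f1 f2 [g1 g2] [a1 a2]; simpc => /=.
rewrite -subr_ge0.
set p := a1 * f1 - a2 * f2; set q := a1 * f2 + a2 * f1.
have -> : (a1 ^+ 2 + a2 ^+ 2) * (f1 ^+ 2 + f2 ^+ 2) = p ^+ 2 + q ^+ 2.
  by rewrite /p /q; ring.
rewrite [leRHS](_ : _ = (p - g1) ^+ 2 + (q - g2) ^+ 2); last by ring.
by rewrite addr_ge0// sqr_ge0.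
Qed.

Definition cintegrable h : Prop :=
  mu.-integrable setT (fun x => (complex.Re (h x))%:E) /\
  mu.-integrable setT (fun x => (complex.Im (h x))%:E).

Definition cintegral h : R[i] :=
  (\int[mu]_x complex.Re (h x)) +i* (\int[mu]_x complex.Im (h x)).

Lemma cintegral_linear (a : R[i]) h g : cintegrable h -> cintegrable g ->
  cintegral (fun x => a * h x + g x) = a * cintegral h + cintegral g.
Proof.
move=> [h1 h2] [g1 g2]; rewrite /cintegral; case: a => a1 a2; simpc.
have Zh1 (c : R) : mu.-integrable setT (EFin \o (fun x => c * complex.Re (h x))).
  exact: (integrableZl measurableT c h1).
have Zh2 (c : R) : mu.-integrable setT (EFin \o (fun x => c * complex.Im (h x))).
  exact: (integrableZl measurableT c h2).
rewrite -!(RintegralZl _ measurableT h1) -!(RintegralZl _ measurableT h2).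
have I1 := integrableB measurableT (Zh1 a1) (Zh2 a2).
have I2 := integrableD measurableT (Zh2 a1) (Zh1 a2).
congr (_ +i* _).
- rewrite -RintegralB// -(RintegralD measurableT I1 g1).
  by apply: eq_Rintegral => x _; case: (h x) (g x) => ? ? [].
- rewrite -(RintegralD measurableT (Zh2 a1) (Zh1 a2)).
  rewrite -(RintegralD measurableT I2 g2).
  by apply: eq_Rintegral => x _; case: (h x) (g x) => ? ? [].
Qed.

Lemma cintegral_conj h : cintegrable h ->
  cintegral (fun x => (h x)^*) = (cintegral h)^*.
Proof.
move=> [h1 h2]; rewrite /cintegral/=; congr (_ +i* _).
  by apply: eq_Rintegral => x _; case: (h x).
rewrite -[RHS]mulN1r -RintegralZl//; apply: eq_Rintegral => x _.
by rewrite mulN1r; case: (h x).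
Qed.

Lemma ae_eq_cintegral h g : measurable_cfun h -> measurable_cfun g ->
  {ae mu, forall x, h x = g x} -> cintegral h = cintegral g.
Proof.
move=> [h1 h2] [g1 g2] hg; rewrite /cintegral /Rintegral.
congr (fine _ +i* fine _); apply: ae_eq_integral => //;
  by [exact/measurable_EFinP | apply: filterS hg => x /= ->].
Qed.

Lemma square_integrable_mul f g : square_integrable f -> square_integrable g ->
  cintegrable (fun x => f x * (g x)^*).
Proof.
move=> /square_integrableP[mf fi] /square_integrableP[mg gi].
have [mr mi] := measurable_cfunM mf (measurable_cfunC mg).
have fgi := integrableD measurableT fi gi.
split.
- apply: le_integrable fgi => //; first exact/measurable_EFinP.
  move=> x _ /=; rewrite lee_fin [leRHS]ger0_norm ?addr_ge0 ?sqr_ge0//.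
  rewrite !rnorm2E; case: (f x) (g x) => a b [c e]; simpc => /=.
  rewrite ler_norml -subr_ge0 opprK.
  rewrite [X in 0 <= X](_ : _ = ((a + c) ^+ 2 + (b + e) ^+ 2 +
    (a ^+ 2 + b ^+ 2 + (c ^+ 2 + e ^+ 2))) / 2); last by field.
  rewrite -[X in _ && X]subr_ge0.
  rewrite [X in _ && (0 <= X)](_ : _ = ((a - c) ^+ 2 + (b - e) ^+ 2 +
    (a ^+ 2 + b ^+ 2 + (c ^+ 2 + e ^+ 2))) / 2); last by field.
  by rewrite !divr_ge0// !addr_ge0// sqr_ge0.
- apply: le_integrable fgi => //; first exact/measurable_EFinP.
  move=> x _ /=; rewrite lee_fin [leRHS]ger0_norm ?addr_ge0 ?sqr_ge0//.
  rewrite !rnorm2E; case: (f x) (g x) => a b [c e]; simpc => /=.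
  rewrite ler_norml -subr_ge0 opprK.
  rewrite [X in 0 <= X](_ : _ = ((a - e) ^+ 2 + (b + c) ^+ 2 +
    (a ^+ 2 + b ^+ 2 + (c ^+ 2 + e ^+ 2))) / 2); last by field.
  rewrite -[X in _ && X]subr_ge0.
  rewrite [X in _ && (0 <= X)](_ : _ = ((a + e) ^+ 2 + (b - c) ^+ 2 +
    (a ^+ 2 + b ^+ 2 + (c ^+ 2 + e ^+ 2))) / 2); last by field.
  by rewrite !divr_ge0// !addr_ge0// sqr_ge0.
Qed.

HB.instance Definition _ :=
  GRing.isSubmodClosed.Build R[i] (T -> R[i]) L2_pred square_integrable_submod.

Record sqfun := SqFun {
  sqfun_val :> T -> R[i] ;
  sqfun_valP : sqfun_val \in L2_pred
}.

HB.instance Definition _ := [isSub for sqfun_val].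
HB.instance Definition _ := [Choice of sqfun by <:].
HB.instance Definition _ := [SubChoice_isSubLmodule of sqfun by <:].

Definition null_pred : {pred sqfun} :=
  [pred f : sqfun | `[< {ae mu, forall x, f x = 0} >]].

Lemma null_zmod_closed : zmod_closed null_pred.
Proof.
split; first by rewrite inE; apply/nearW.
move=> f g; rewrite !inE => f0 g0.
by apply: filterS2 f0 g0 => x; rewrite /= !fctE => -> ->; rewrite subr0.
Qed.

HB.instance Definition _ := GRing.isZmodClosed.Build sqfun null_pred
  null_zmod_closed.

(** The space L^2(T, mu) of complex-valued functions, modulo equality almost
    everywhere: the quotient of [sqfun] by the functions in [null_pred]. *)
Definition L2 : Type := Quotient.quot null_pred.
HB.instance Definition _ := GRing.Zmodule.on L2.
HB.instance Definition _ := EqQuotient.on L2.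


Definition L2_fun (u : L2) : T -> R[i] := sqfun_val (repr u).

(** The class of [f], and [0] when [f] is not square-integrable. *)
Definition L2_class f : L2 := \pi_(L2) (insubd (0 : sqfun) f).

Lemma L2_fun_square_integrable (u : L2) : square_integrable (L2_fun u).
Proof. by have := sqfun_valP (repr u); rewrite inE. Qed.

Lemma L2_piP (f g : sqfun) :
  \pi_(L2) f = \pi_(L2) g <-> {ae mu, forall x, f x = g x}.
Proof.
have -> : (\pi_(L2) f = \pi_(L2) g) <-> f - g \in null_pred.
  by rewrite Quotient.idealrBE; split=> /eqP.
rewrite inE; split; apply: filterS => x /=; rewrite !fctE.
  by move=> /eqP; rewrite subr_eq0 => /eqP.
by move=> ->; rewrite subrr.
Qed.

Lemma L2_fun_pi (f : sqfun) : {ae mu, forall x, L2_fun (\pi_(L2) f) x = f x}.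
Proof. by apply/L2_piP; rewrite reprK. Qed.

Lemma L2_funP (u v : L2) :
  u = v <-> {ae mu, forall x, L2_fun u x = L2_fun v x}.
Proof. by rewrite -{1}(reprK u) -{1}(reprK v); exact: L2_piP. Qed.

Lemma L2_piD (f g : sqfun) : \pi_(L2) (f + g) = \pi_(L2) f + \pi_(L2) g.
Proof. exact: (raddfD \pi_(Quotient.quot null_pred) f g). Qed.

Lemma L2_pi0 : \pi_(L2) 0 = 0.
Proof. exact: (raddf0 \pi_(Quotient.quot null_pred)). Qed.

Definition L2_scale (a : R[i]) (u : L2) : L2 := \pi_(L2) (a *: repr u).

Lemma L2_piZ a (f : sqfun) : L2_scale a (\pi_(L2) f) = \pi_(L2) (a *: f).
Proof.
apply/L2_piP; apply: filterS (L2_fun_pi f) => x fx.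
exact: (congr1 ( *%R a) fx).
Qed.

Let scaleA a b (u : L2) : L2_scale a (L2_scale b u) = L2_scale (a * b) u.
Proof. by elim/quotW: u => f; rewrite (L2_piZ b f) !L2_piZ scalerA. Qed.

Let scale1 : left_id 1 L2_scale.
Proof. by elim/quotW => f; rewrite !L2_piZ scale1r. Qed.

Let scaleDr : right_distributive L2_scale +%R.
Proof.
move=> a; elim/quotW => f; elim/quotW => g.
by rewrite -L2_piD !L2_piZ scalerDr L2_piD.
Qed.

Let scaleDl u : {morph L2_scale^~ u : a b / a + b}.
Proof. by move=> a b; elim/quotW: u => f; rewrite !L2_piZ scalerDl L2_piD. Qed.

HB.instance Definition _ := GRing.Zmodule_isLmodule.Build R[i] L2
  scaleA scale1 scaleDr scaleDl.

Lemma L2_fun_linear a (u v : L2) :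
  {ae mu, forall x, L2_fun (a *: u + v) x = a * L2_fun u x + L2_fun v x}.
Proof.
elim/quotW: u => f; elim/quotW: v => g.
rewrite [a *: _]L2_piZ -L2_piD.
apply: filterS3 (L2_fun_pi (a *: f + g)) (L2_fun_pi f) (L2_fun_pi g) => x.
by move=> -> -> ->.
Qed.

Definition L2_inner (u v : L2) : R[i] :=
  cintegral (fun x => L2_fun u x * (L2_fun v x)^*).

Let L2_inner_mul_cintegrable (u v : L2) :
  cintegrable (fun x => L2_fun u x * (L2_fun v x)^*).
Proof. by apply: square_integrable_mul; exact: L2_fun_square_integrable. Qed.

Let measurable_L2_fun (u : L2) : measurable_cfun (L2_fun u).
Proof. by case: (L2_fun_square_integrable u). Qed.

Let L2_inner_linearl w : linear_for *%R (L2_inner^~ w).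
Proof.
move=> a u v; rewrite /L2_inner -cintegral_linear//.
apply: ae_eq_cintegral.
- exact/measurable_cfunM/measurable_cfunC.
- apply: measurable_cfunD; last exact/measurable_cfunM/measurable_cfunC.
  apply: measurable_cfunM; first exact: measurable_cfun_cst.
  exact/measurable_cfunM/measurable_cfunC.
- by apply: filterS (L2_fun_linear a u v) => x /= ->; rewrite mulrDl mulrA.
Qed.

Let L2_innerC u v : L2_inner u v = (L2_inner v u)^*.
Proof.
rewrite /L2_inner -cintegral_conj//; congr cintegral; apply/funext => x.
by rewrite rmorphM/= conjcK mulrC.
Qed.

Let L2_inner_linearr w : linear_for (Num.conj \; *%R) (L2_inner w).
Proof.
move=> a u v; rewrite L2_innerC L2_inner_linearl rmorphD rmorphM/=.
by rewrite (L2_innerC w u) (L2_innerC w v).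
Qed.

HB.instance Definition _ := bilinear_isBilinear.Build R[i] L2 L2 R[i]
  *%R (Num.conj \; *%R) L2_inner (L2_inner_linearl, L2_inner_linearr).

HB.instance Definition _ := @isHermitianSesquilinear.Build R[i] L2 false
  Num.conj L2_inner (fun u v => etrans (L2_innerC u v) (esym (mul1r _))).

Lemma L2_innerE (u : L2) :
  L2_inner u u = (\int[mu]_x (rnorm (L2_fun u x) ^+ 2))%:C.
Proof.
congr (_ +i* _).
  apply: eq_Rintegral => x _; rewrite rnorm2E; case: (L2_fun u x) => a b.
  by rewrite /= mulrN opprK !expr2.
rewrite -[RHS](mul0r (fine (mu setT))) -Rintegral_cst//.
apply: eq_Rintegral => x _.
by case: (L2_fun u x) => a b /=; rewrite mulrN mulrC addNr.
Qed.


Let L2_inner_gt0 (u : L2) : u != 0 -> 0 < L2_inner u u.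
Proof.
apply: contra_neqT; rewrite L2_innerE => u0.
have /square_integrableP[mf fi] := L2_fun_square_integrable u.
have I0 : \int[mu]_x (rnorm (L2_fun u x) ^+ 2) = 0.
  apply/eqP; rewrite eq_le Rintegral_ge0 ?andbT; last by move=> x _; rewrite sqr_ge0.
  by rewrite leNgt; move: u0; rewrite ltcR.
have : (\int[mu]_x `|(rnorm (L2_fun u x) ^+ 2)%:E|)%E = 0%E.
  under eq_integral do rewrite gee0_abs ?lee_fin ?sqr_ge0//.
  rewrite -[LHS]fineK; last exact: integrable_fin_num.
  by congr (_%:E); exact: I0.
move/(ae_eq_integral_abs mu measurableT (measurable_int mu fi)) => f0.
rewrite -L2_pi0; apply/L2_funP.
apply: filterS2 f0 (L2_fun_pi 0) => x /= /(_ I) [] fx0 ->.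
move: fx0 => /eqP; rewrite expf_eq0/= => /eqP r0.
have : rnorm (L2_fun u x) ^+ 2 = 0 by rewrite r0 expr0n.
rewrite rnorm2E; case: (L2_fun u x) => a b /= /eqP.
by rewrite paddr_eq0 ?sqr_ge0// !expf_eq0/= => /andP[/eqP -> /eqP ->].
Qed.

HB.instance Definition _ := isDotProduct.Build R[i] L2 L2_inner L2_inner_gt0.

Definition L2_norm (u : L2) : R[i] :=
  (Num.sqrt (\int[mu]_x (rnorm (L2_fun u x) ^+ 2)))%:C.

Let L2_normE u : L2_norm u = (Num.sqrt (complex.Re (L2_inner u u)))%:C.
Proof. by rewrite L2_innerE. Qed.

Let L2_norm_sqr u : L2_norm u ^+ 2 = L2_inner u u.
Proof.
rewrite L2_innerE -rmorphXn/= sqr_sqrtr//.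
by apply: Rintegral_ge0 => x _; exact: sqr_ge0.
Qed.

Let L2_norm_ge0 u : 0 <= L2_norm u.
Proof. by rewrite lecR sqrtr_ge0. Qed.

Let L2_normD u v : L2_norm (u + v) <= L2_norm u + L2_norm v.
Proof. by rewrite !L2_normE -rmorphD lecR; exact: dot_sqrtD. Qed.

Let L2_normZ a u : L2_norm (a *: u) = `|a| * L2_norm u.
Proof.
apply/eqP; rewrite -(@eqrXn2 _ 2)// ?mulr_ge0// exprMn !L2_norm_sqr.
by rewrite linearZl_LR/= linearZr_LR/= mulrA -normCK.
Qed.

Let L2_norm0_eq0 u : L2_norm u = 0 -> u = 0.
Proof.
move=> u0; apply/eqP; apply: contraTT isT => /L2_inner_gt0.
by rewrite -L2_norm_sqr u0 expr0n ltxx.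
Qed.

HB.instance Definition _ := Lmodule_isNormed.Build R[i] L2
  L2_normD L2_normZ L2_norm0_eq0.

HB.instance Definition _ := NormedModule_isPreHilbert.Build R L2 L2_norm_sqr.

End SquareIntegrable.

(** A partially defined operator: [op_fun] is meaningful on [op_dom] only, its
    values elsewhere are junk and never enter the notions below. *)
Record partial_op (U V : Type) := PartialOp {
  op_dom : set U ;
  op_fun :> U -> V
}.

Definition op_of (U V : Type) (f : U -> V) : partial_op U V :=
  PartialOp setT f.

Definition op_comp (U V W : Type) (B : partial_op V W) (A : partial_op U V) :
    partial_op U W :=
  PartialOp (op_dom A `&` A @^-1` op_dom B) (B \o A).

Definition op_sub (U : Type) (V : zmodType) (A B : partial_op U V) :
    partial_op U V :=
  PartialOp (op_dom A `&` op_dom B) (fun x => A x - B x).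

Definition op_extends (U V : Type) (A B : partial_op U V) : Prop :=
  forall x, op_dom A x -> op_dom B x /\ B x = A x.

Section Operators.
Context (R : realType) (U V : normedModType R[i]).

Definition linear_op (A : partial_op U V) : Prop :=
  op_dom A 0 /\
  forall (a : R[i]) (x y : U), op_dom A x -> op_dom A y ->
    op_dom A (a *: x + y) /\ A (a *: x + y) = a *: A x + A y.

Definition closed_op (A : partial_op U V) : Prop :=
  closed [set p : U * V | op_dom A p.1 /\ p.2 = A p.1].

Definition densely_defined (A : partial_op U V) : Prop := dense (op_dom A).

Definition bounded_op (E : {linear U -> V}) : Prop :=
  exists M : R, forall x, rnorm (E x) <= M * rnorm x.

Definition opnorm (E : {linear U -> V}) : R :=
  sup [set rnorm (E x) | x in [set x | rnorm x <= 1]].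

Definition norm_preserving (E : {linear U -> V}) : Prop :=
  forall x, `|E x| = `|x|.

End Operators.

Definition is_adjoint (R : realType) (H K : preHilbertType R)
    (E : {linear H -> K}) (F : {linear K -> H}) : Prop :=
  forall x y, inner (E x) y = inner x (F y).

Definition mult_op d (T : measurableType d) (R : realType)
    (mu : {measure set T -> \bar R}) (g : T -> R[i]) :
    partial_op (L2 mu) (L2 mu) :=
  PartialOp [set f | square_integrable mu (fun x => g x * L2_fun f x)]
            (fun f => L2_class mu (fun x => g x * L2_fun f x)).

(** [M] equipped with its Borel sigma-algebra. *)
Notation borel M := (g_sigma_algebraType (@open M)).

Section CondensedSVD.
Context (R : realType) (H K : hilbertType R) (M : ptopologicalType).
Variable mu : {measure set (borel M) -> \bar R}.

Definition real_mult_op (g : borel M -> R) : partial_op (L2 mu) (L2 mu) :=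
  mult_op mu (fun x => (g x)%:C).

(** [Vadj] is the adjoint of [V]; being an adjoint determines it uniquely. *)
Record condensed_svd (A : partial_op H K)
    (U : {linear L2 mu -> K}) (V : {linear L2 mu -> H})
    (Vadj : {linear H -> L2 mu}) (sigma : borel M -> R) : Prop := {
  svd_sigma_finite : sigma_finite setT mu ;
  svd_isometryU : norm_preserving U ;
  svd_isometryV : norm_preserving V ;
  svd_adjoint : is_adjoint V Vadj ;
  svd_measurable : measurable_fun setT sigma ;
  svd_ge0 : forall x, 0 <= sigma x ;
  svd_ae_gt0 : {ae mu, forall x, 0 < sigma x} ;
  svd_dom : op_dom A = [set x | op_dom (real_mult_op sigma) (Vadj x)] ;
  svd_val : forall x, op_dom A x -> A x = U (real_mult_op sigma (Vadj x))
}.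

End CondensedSVD.

(* Main.v *)
(** On the domain of [A] the difference is [U T_h V^*] with
    [h = 1_{sigma < eps} sigma]. Since [0 <= h <= eps], the multiplication by
    [h] is everywhere defined on [L^2] with norm at most [eps]; [U] is an
    isometry and [V^*] a contraction, so [E = U T_h V^*] is the extension. The
    operator [T_{1_{sigma >= eps} sigma}] is defined wherever [T_sigma] is, so
    the difference has the dense domain of [A], which gives uniqueness. *)

Require Import Defs.
From HB Require Import structures.
From mathcomp Require Import all_boot all_order all_algebra.
From mathcomp Require Import complex.
From mathcomp Require Import all_classical all_reals all_analysis.
From mathcomp Require Import measurable_realfun.

Set Implicit Arguments.
Unset Strict Implicit.
Unset Printing Implicit Defensive.

Import Order.TTheory GRing.Theory Num.Theory.
Import numFieldNormedType.Exports.

Local Open Scope classical_set_scope.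
Local Open Scope ring_scope.
Local Open Scope complex_scope.

Section Rnorm.
Context (R : realType) (V : normedZmodType R[i]).
Implicit Types x y : V.

(** In the order of [R[i]] a nonnegative element has zero imaginary part, so [rnorm] loses
    nothing. *)
Lemma rnormE x : `|x| = (rnorm x)%:C.
Proof.
have := normr_ge0 x; rewrite lecE => /andP[/eqP/= im0 _].
by apply/eqP; rewrite eq_complex /rnorm/= im0 !eqxx.
Qed.

Lemma ler_rnormD x y : rnorm (x + y) <= rnorm x + rnorm y.
Proof. by rewrite -lecR rmorphD/= -!rnormE; exact: ler_normD. Qed.

Lemma rnormN x : rnorm (- x) = rnorm x.
Proof. by rewrite /rnorm normrN. Qed.

Lemma rnorm0 : rnorm (0 : V) = 0.
Proof. by rewrite /rnorm normr0. Qed.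

Lemma rnorm_le0_eq0 x : rnorm x <= 0 -> x = 0.
Proof.
move=> x0; apply: normr0_eq0; rewrite rnormE.
by congr (_ %:C); apply/eqP; rewrite eq_le x0 rnorm_ge0.
Qed.

End Rnorm.

Lemma rnormM (R : realType) (a b : R[i]) : rnorm (a * b) = rnorm a * rnorm b.
Proof. by apply: complexI; rewrite rmorphM/= -!rnormE normrM. Qed.

Lemma rnorm_real (R : realType) (a : R) : 0 <= a -> rnorm (a%:C : R[i]) = a.
Proof.
move=> a0.
by rewrite /rnorm normc_def/= expr0n/= addr0 sqrtr_sqr ger0_norm.
Qed.

Section Multiplication.
Context d (T : measurableType d) (R : realType).
Variable mu : {measure set T -> \bar R}.

(** Square-integrability rules out the default [0] of [insubd]; choosing a representative then
    alters [f] only on a null set. *)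
Lemma L2_fun_class (f : T -> R[i]) : square_integrable mu f ->
  {ae mu, forall x, L2_fun (L2_class mu f) x = f x}.
Proof.
move=> f2; have fL : f \in L2_pred mu by rewrite inE.
apply: filterS (L2_fun_pi (insubd (0 : sqfun mu) f)) => x ->.
by rewrite -[X in X x]/(val _) insubdK.
Qed.

Lemma L2_rnorm2 (u : L2 mu) :
  rnorm u ^+ 2 = \int[mu]_x (rnorm (L2_fun u x) ^+ 2).
Proof.
by apply: complexI; rewrite rmorphXn/= -rnormE inner_norm; exact: L2_innerE.
Qed.

Section BoundedMultiplier.
Variables (g : T -> R) (c : R).
Hypotheses (mg : measurable_fun setT g) (g0 : forall x, 0 <= g x)
  (gc : forall x, g x <= c).

Lemma rnorm_mulr_bound (z : R[i]) x :
  rnorm ((g x)%:C * z) ^+ 2 <= c ^+ 2 * rnorm z ^+ 2.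
Proof.
rewrite rnormM rnorm_real// -exprMn lerXn2r ?nnegrE ?mulr_ge0 ?rnorm_ge0//.
  exact: le_trans (gc x).
by rewrite ler_wpM2r ?rnorm_ge0.
Qed.

(** Domination by [c ^+ 2] times the integrable squared norm of [f]. It serves both for the bounded
    part of [sigma] and, with [c = 1], for an indicator. *)
Lemma square_integrable_mulr_bound (f : T -> R[i]) : square_integrable mu f ->
  square_integrable mu (fun x => (g x)%:C * f x).
Proof.
move=> /square_integrableP[mf fi].
have mgf : measurable_cfun (fun x => (g x)%:C * f x).
  by apply: measurable_cfunM => //; split=> //; exact: measurable_cst.
apply/square_integrableP; split=> //.
apply: le_integrable (integrableZl measurableT (c ^+ 2) fi) => //.
  exact/measurable_EFinP/measurable_rnorm2.
move=> x _ /=; rewrite lee_fin !ger0_norm ?sqr_ge0//.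
  exact: rnorm_mulr_bound.
by rewrite mulr_ge0 ?sqr_ge0.
Qed.

Lemma bounded_multiplier : exists G : {linear L2 mu -> L2 mu},
  (forall u, {ae mu, forall x, L2_fun (G u) x = (g x)%:C * L2_fun u x}) /\
  (forall u, rnorm (G u) <= c * rnorm u).
Proof.
pose G (u : L2 mu) := L2_class mu (fun x => (g x)%:C * L2_fun u x).
have sG (u : L2 mu) : square_integrable mu (fun x => (g x)%:C * L2_fun u x).
  exact: square_integrable_mulr_bound (L2_fun_square_integrable u).
have GE (u : L2 mu) := L2_fun_class (sG u).
have linG : linear G.
  move=> a u v; apply/L2_funP.
  (* Representatives are known only almost everywhere, so the identity is checked where five such
     equalities hold together. *)
  apply: filterS2 (filterI (GE (a *: u + v)) (L2_fun_linear a u v))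
    (filterI (L2_fun_linear a (G u) (G v)) (filterI (GE u) (GE v))).
  move=> x /= [-> ->] [-> [-> ->]].
  by rewrite mulrDr mulrCA.
pose GL := GRing.isLinear.Build _ _ _ _ G linG.
exists (HB.pack_for {linear L2 mu -> L2 mu} G GL); split=> // u.
(* [T] is pointed, so the bounds on [g] can be compared at a point. *)
have c0 : 0 <= c by exact: le_trans (g0 point) (gc point).
rewrite -(@ler_pXn2r _ 2)// ?nnegrE ?mulr_ge0 ?rnorm_ge0//.
rewrite exprMn !L2_rnorm2.
have /square_integrableP[mu2 iu] := L2_fun_square_integrable u.
have /square_integrableP[mGu iGu] := L2_fun_square_integrable (G u).
have /square_integrableP[mgu igu] := sG u.
rewrite -RintegralZl//.
(* The representative of [G u] gives way to the actual product, for which the bound holds at every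
   point. *)
rewrite [leLHS](_ : _ = \int[mu]_x rnorm ((g x)%:C * L2_fun u x) ^+ 2); last first.
  congr fine; apply: ae_eq_integral => //;
    try exact/measurable_EFinP/measurable_rnorm2.
  by apply: filterS (GE u) => x /= ->.
apply: le_Rintegral => //; first exact: (integrableZl measurableT (c ^+ 2) iu).
by move=> x _; exact: rnorm_mulr_bound.
Qed.

End BoundedMultiplier.
End Multiplication.

Lemma adjoint_contraction (R : realType) (H K : preHilbertType R)
    (V : {linear H -> K}) (W : {linear K -> H}) :
  norm_preserving V -> is_adjoint V W -> forall x, rnorm (W x) <= rnorm x.
Proof.
(* [V W] is an orthogonal projection: [0 <= |x - V W x|^2 = |x|^2 - |W x|^2]. *)
move=> isoV adjV x.
rewrite -(@ler_pXn2r _ 2)// ?nnegrE ?rnorm_ge0// -lecR !rmorphXn/= -!rnormE.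
have VW : inner (V (W x)) x = `|W x| ^+ 2 by rewrite adjV inner_norm.
have WV : inner x (V (W x)) = `|W x| ^+ 2.
  rewrite (@hermitian_subproof _ _ _ _ inner x)/= expr0 mul1r VW.
  by rewrite rmorphXn; congr (_ ^+ 2); apply/conj_Creal/ger0_real.
have := exprn_ge0 2 (normr_ge0 (x - V (W x))).
rewrite inner_norm linearBl linearBr/= linearBr/= VW WV -!inner_norm isoV.
by rewrite subrr subr0 subr_ge0.
Qed.

(** For [y] in [D], [E x - F x = E (x - y) - F (x - y)], which is small when [y] is close to [x]. *)
Lemma dense_bounded_eq (R : realType) (U V : normedModType R[i])
    (D : set U) (E F : {linear U -> V}) :
  dense D -> bounded_op E -> bounded_op F ->
  (forall x, D x -> E x = F x) -> E =1 F.
Proof.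
move=> denseD [ME bE] [MF bF] EF x; apply/eqP; rewrite -subr_eq0; apply/eqP.
apply: rnorm_le0_eq0; apply/ler_addgt0Pr => /= e e0; rewrite add0r.
(* The constants [ME] and [MF] may be negative, hence the absolute values; the [1] makes [C]
   invertible. *)
pose C : R := `|ME| + `|MF| + 1.
have C0 : 0 < C by rewrite ltr_wpDl// addr_ge0.
have d0 : 0 < (e / C)%:C :> R[i] by rewrite ltcR divr_gt0.
have [|y [xy Dy]] := denseD (ball x (e / C)%:C) _ (ball_open x _).
  by exists x; exact: ballxx.
have -> : E x - F x = E (x - y) - F (x - y).
  by rewrite (linearB E) (linearB F) (EF y Dy) opprB addrA subrK.
move: xy; rewrite -ball_normE/= rnormE ltcR => /ltW xy.
apply: le_trans (ler_rnormD _ _) _; rewrite rnormN.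
apply: le_trans (lerD (bE _) (bF _)) _; rewrite -mulrDl.
apply: (@le_trans _ _ (C * rnorm (x - y))); last first.
  by rewrite mulrC -ler_pdivlMr.
rewrite ler_wpM2r ?rnorm_ge0//.
by apply: ler_wpDr => //; rewrite lerD// ler_norm.
Qed.

Lemma opnorm_le (R : realType) (U V : normedModType R[i])
    (E : {linear U -> V}) (c : R) : 0 <= c ->
  (forall x, rnorm (E x) <= c * rnorm x) -> opnorm E <= c.
Proof.
move=> c0 Ec; apply: ge_sup.
  (* Bounding a supremum requires a nonempty set; the vector [0] provides an element. *)
  by exists (rnorm (E 0)), 0 => //=; rewrite rnorm0.
move=> _ [x /= x1 <-]; apply: le_trans (Ec x) _.
by rewrite ler_piMr.
Qed.

Theorem proposition4p2 (R : realType) (H K : hilbertType R)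
  (sepH : separable_space H) (sepK : separable_space K)
  (A : partial_op H K) (linA : linear_op A) (closedA : closed_op A)
  (denseA : densely_defined A)
  (M : ptopologicalType) (mu : {measure set (borel M) -> \bar R})
  (U : {linear L2 mu -> K}) (V : {linear L2 mu -> H})
  (Vadj : {linear H -> L2 mu}) (sigma : borel M -> R)
  (svdA : condensed_svd A U V Vadj sigma)
  (eps : R) (eps_ge0 : 0 <= eps) :
  let B : partial_op H K :=
    op_sub A
      (op_comp (op_of U)
        (op_comp
          (real_mult_op mu (fun x => \1_[set y | eps <= sigma y] x * sigma x))
          (op_of Vadj))) in
  exists E : {linear H -> K},
    [/\ bounded_op E, op_extends B (op_of E), opnorm E <= eps &
        forall E' : {linear H -> K},
          bounded_op E' -> op_extends B (op_of E') -> E' =1 E].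
Proof.
move=> B.
have [_ isoU isoV adjV msigma sigma0 _ domA valA] := svdA.
pose P : set (borel M) := [set y | eps <= sigma y].
have mP : measurable P.
  rewrite -[P]setTI (_ : P = sigma @^-1` `[eps, +oo[); first exact: msigma.
  by apply/seteqP; split=> x /=; rewrite in_itv/= andbT.
pose g x := \1_P x * sigma x.
(* Defining [h] as a difference makes [g + h = sigma] hold by cancellation. *)
pose h x := sigma x - g x.
have gh (x : borel M) : (P x /\ g x = sigma x /\ h x = 0) \/
    (~ P x /\ g x = 0 /\ h x = sigma x).
  rewrite /h /g indicE; have [xP|xP] := boolP (x \in P).
    by left; rewrite mul1r subrr; split=> //; rewrite inE in xP.
  by right; rewrite mul0r subr0; split=> //; rewrite notin_setE in xP.
have mg : measurable_fun setT g by exact: measurable_funM.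
have mh : measurable_fun setT h by exact: measurable_funB.
have gs x : g x <= sigma x by case: (gh x) => -[_ [-> _]].
have h0 x : 0 <= h x by rewrite subr_ge0.
have h_le x : h x <= eps.
  (* On [P] this is [0 <= eps]; off [P], [sigma x < eps]. *)
  case: (gh x) => -[Px [_ ->]] //.
  by rewrite leNgt; apply/negP => /ltW.
have [G [GE Gle]] := bounded_multiplier mu mh h0 h_le.
pose E : {linear H -> K} := U \o G \o Vadj.
have Ele x : rnorm (E x) <= eps * rnorm x.
  rewrite {1}/rnorm isoU; apply: le_trans (Gle _) _.
  by rewrite ler_wpM2l// (adjoint_contraction isoV adjV).
have m1P : measurable_fun setT (\1_P : borel M -> R) by exact: measurable_indic.
have P0 (x : borel M) : 0 <= \1_P x :> R by rewrite indicE ler0n.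
have P1 (x : borel M) : \1_P x <= 1 :> R by rewrite indicE lern1 leq_b1.
have bE : bounded_op E by exists eps.
(* Only the domain of the truncated multiplication needs care: its product is [\1_P], bounded by
   [1], times the square-integrable product with [sigma]. *)
have domB : op_dom B = op_dom A.
  apply/seteqP; split=> [x []//|x Ax]; split=> //; split=> //; split=> //.
  move: Ax; rewrite domA => /= /(square_integrable_mulr_bound m1P P0 P1).
  by under eq_fun do rewrite mulrA -rmorphM.
have EB : op_extends B (op_of E).
  move=> x Bx; split=> //; have Ax : op_dom A x by rewrite -domB.
  have [_ [[_ /= g2] _]] := Bx; have := Ax; rewrite domA => /= s2.
  (* Moving the subtracted term across and removing [U] leaves [sigma = h + g] as multipliers of
     [Vadj x]. *)
  rewrite /= valA//; apply/eqP; rewrite eq_sym subr_eq -linearD; apply/eqP.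
  congr (U _); apply/L2_funP.
  (* The factor [1] gives the sum the shape [a *: u + v] of [L2_fun_linear]. *)
  rewrite -[G _]scale1r.
  apply: filterS2 (filterI (L2_fun_linear 1 (G (Vadj x))
    (real_mult_op mu g (Vadj x))) (GE (Vadj x)))
    (filterI (L2_fun_class s2) (L2_fun_class g2)).
  move=> y /= [-> ->] [-> ->].
  by rewrite mul1r -mulrDl -rmorphD /h subrK.
exists E; split=> //; first exact: opnorm_le.
move=> F bF FB; apply: dense_bounded_eq denseA bF bE _ => x.
by rewrite -domB => Bx; have [_ /= ->] := FB x Bx; have [_ /= ->] := EB x Bx.
Qed.
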